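(* Let $(\Omega,\mathcal A)$ be a measurable space, $\mathcal P$ a nonempty set of probability measures on it, $\mathbb V(A)=\sup_{Q\in\mathcal P}Q(A)$ for $A\in\mathcal A$, and $\mathbb E[X]=\sup_{Q\in\mathcal P}E_Q[X]$. Let $\{X_n\}_{n\in\mathbb N}$ be real random variables on $(\Omega,\mathcal A)$ that are negatively dependent with respect to $\mathbb E$, with $\mathbb E[e^{\delta|X_n|}]<\infty$ for all $\delta>0$ and $n\in\mathbb N$. Let $\overline X_n=\frac1n\sum_{i=1}^nX_i$. Assume that for every $\lambda\in\mathbb R$ the limit $$\Lambda(\lambda)=\lim_{n\to\infty}\frac1n\sum_{i=1}^n\ln\mathbb E[e^{\lambda X_i}]$$ exists as an extended real number, and that $0\in\mathrm{int}(\mathrm{dom}(\Lambda))$. Let $\Gamma(\lambda)=\limsup_{n\to\infty}\frac1n\ln\mathbb E[e^{n\lambda\overline X_n}]$ for $\lambda\in\mathbb R$. Then for all closed $F\subset\mathbb R$ and open $G\subset\mathbb R$, $$\limsup_{n\to\infty}\frac1n\ln\mathbb V(\overline X_n\in F)\le-\inf_{x\in F}\Gamma^*(x)\le-\inf_{x\in F}\Lambda^*(x)$$ and $$\liminf_{n\to\infty}\frac1n\ln\mathbb V(\overline X_n\in G)\ge-\inf_{x\in G\cap\tilde{\mathcal E}(\Gamma^* )}\Gamma^*(x).$$ If, moreover, $\{X_n\}_{n\in\mathbb N}$ are independent with respect to $\mathbb E$, then $\Lambda=\Gamma$, $\Lambda^*=\Gamma^*$, $\mathcal E(\Lambda^*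 )\subset\tilde{\mathcal E}(\Gamma^* )$, and for all closed $F\subset\mathbb R$ and open $G\subset\mathbb R$, $$\limsup_{n\to\infty}\frac1n\ln\mathbb V(\overline X_n\in F)\le-\inf_{x\in F}\Lambda^*(x),\qquad \liminf_{n\to\infty}\frac1n\ln\mathbb V(\overline X_n\in G)\ge-\inf_{x\in G\cap\mathcal E(\Lambda^* )}\Lambda^*(x).$$
   Context: Conventions: $\ln 0=-\infty$, $\inf\emptyset=+\infty$. $E_Q$ is expectation with respect to a probability measure $Q$. Random variables $\{X_n\}$ are negatively dependent with respect to $\mathbb E$ if for any $n\in\mathbb N$ and any Borel functions $\varphi_i:\mathbb R\to[0,\infty)$, $$\mathbb E[\varphi_1(X_1)\cdots\varphi_{n+1}(X_{n+1})]\le\mathbb E[\varphi_1(X_1)\cdots\varphi_n(X_n)]\cdot\mathbb E[\varphi_{n+1}(X_{n+1})]$$ whenever the upper expectations are finite; they are independent with respect to $\mathbb E$ if these inequalities are all equalities. $\mathrm{dom}(f)=\{x\in\mathbb R: f(x)<\infty\}$; $f^*(x)=\sup_{\lambda\in\mathbb R}(\lambda x-f(\lambda))$ is the Fenchel–Legendre transform. A point $y\in\mathbb R$ is an exposed point of $f^*$ with exposing hyperplane $\lambda\in\mathbb R$ if $\lambda y-f^*(y)>\lambda x-f^*(x)$ for all $x\ne y$. $\mathcal E(\Lambda^* )$ is the set of exposed points of $\Lambda^*$ admitting an exposing hyperplane $\lambda\in\mathrm{int}(\mathrm{dom}(\Lambda))$. $\tilde{\mathcal E}(\Gamma^* )$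 is the set of exposed points of $\Gamma^*$ admitting an exposing hyperplane $\lambda$ such that the limit superior defining $\Gamma(\lambda)$ is a limit and $\Gamma(t\lambda)<\infty$ for some $t>1$. *)

(* Defs.v *)
From HB Require Import structures.
From mathcomp Require Import all_boot all_order all_algebra.
From mathcomp Require Import all_classical all_reals all_analysis.

Set Implicit Arguments.
Unset Strict Implicit.
Unset Printing Implicit Defensive.

Import Order.TTheory GRing.Theory Num.Theory.
Import numFieldNormedType.Exports.

Local Open Scope classical_set_scope.
Local Open Scope ring_scope.
Local Open Scope ereal_scope.

Section upper_probability.
Context (d : measure_display) (T : measurableType d) (R : realType).
Implicit Types (P : set (probability T R)) (X : nat -> {mfun T >-> R}).

Definition upper_prob P (A : set T) : \bar R :=
  ereal_sup [set (Q : probability T R) A | Q in P].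

(* Only applied to nonnegative functions, for which 'E_Q[Y] is well defined
   in [0, +oo]. *)
Definition upper_expectation P (Y : T -> R) : \bar R :=
  ereal_sup [set 'E_Q[Y] | Q in P].

(* The sequence X_1, X_2, ... is represented by X 0, X 1, ... *)
Definition sample_mean X (n : nat) (w : T) : R :=
  (n%:R^-1 * \sum_(i < n) X i w)%R.

(* Since the indices are shifted, [\prod_(i < n.+1) phi i (X i w)] stands for
   phi_1(X_1) ... phi_{n+1}(X_{n+1}), and [X n] for X_{n+1}. *)
Definition product_rule (rel_op : \bar R -> \bar R -> Prop) P X : Prop :=
  forall (n : nat) (phi : nat -> R -> R),
    (0 < n)%N ->
    (forall i, measurable_fun [set: R] (phi i)) ->
    (forall i x, (0 <= phi i x)%R) ->
    let lhs :=
      upper_expectation P (fun w => \prod_(i < n.+1) phi i (X i w))%R in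
    let rhs1 :=
      upper_expectation P (fun w => \prod_(i < n) phi i (X i w))%R in
    let rhs2 := upper_expectation P (fun w => phi n (X n w)) in
    lhs \is a fin_num -> rhs1 \is a fin_num -> rhs2 \is a fin_num ->
    rel_op lhs (rhs1 * rhs2).

Definition negatively_dependent P X : Prop :=
  product_rule (fun a b => a <= b) P X.

Definition independent P X : Prop := product_rule (fun a b => a = b) P X.

(* For n = 0 the sequences below have the junk factor 0^-1 = 0; this does not
   affect their asymptotics. *)
Definition Lambda_seq P X (l : R) (n : nat) : \bar R :=
  (n%:R^-1)%:E *
  \sum_(i < n) lne (upper_expectation P (fun w => expR (l * X i w)%R)).

Definition Lambda P X (l : R) : \bar R := limn (Lambda_seq P X l).

Definition Gamma_seq P X (l : R) (n : nat) : \bar R :=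
  (n%:R^-1)%:E *
  lne (upper_expectation P (fun w => expR (n%:R * l * sample_mean X n w)%R)).

Definition Gamma P X (l : R) : \bar R := limn_esup (Gamma_seq P X l).

Definition log_prob_seq P X (A : set R) (n : nat) : \bar R :=
  (n%:R^-1)%:E * lne (upper_prob P (sample_mean X n @^-1` A)).

End upper_probability.

Section convex_duality.
Context (R : realType).
Implicit Types (f g : R -> \bar R).

Definition dom f : set R := [set x | f x < +oo].

Definition fenchel_legendre f (x : R) : \bar R :=
  ereal_sup [set (l * x)%:E - f l | l in [set: R]].

Definition exposed_with g (y l : R) : Prop :=
  forall x : R, x != y -> (l * x)%:E - g x < (l * y)%:E - g y.

End convex_duality.

Section exposed_points.
Context (d : measure_display) (T : measurableType d) (R : realType).
Implicit Types (P : set (probability T R)) (X : nat -> {mfun T >-> R}).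

Definition exposed_Lambda P X : set R :=
  [set y | exists l : R,
    exposed_with (fenchel_legendre (Lambda P X)) y l /\
    interior (dom (Lambda P X)) l].

Definition exposed_Gamma P X : set R :=
  [set y | exists l : R,
    [/\ exposed_with (fenchel_legendre (Gamma P X)) y l,
        Gamma_seq P X l @ \oo --> Gamma P X l &
        exists t : R, (1 < t)%R /\ Gamma P X (t * l)%R < +oo]].

End exposed_points.

(* Main.v *)
(* The Gartner-Ellis method works for upper expectations because only
   monotonicity, subadditivity and positive homogeneity are needed. Tilting
   E[Y] to E[e^(n l M_n) Y] and applying Chernoff's bound, a half-line {x | b
   < t x} has tilted mass at most e^(n r') with r' < r as soon as Gamma(l + t)
   < r + b. If every point of a closed set lies in such a half-line, and Gamma
   is finite on both sides of l, then two half-lines cover the tails and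
   compactness leaves finitely many others. For l = 0 this is the upper bound.
   For the lower bound, let l expose y and r = Gamma(l): the complement of a
   ball around y decays faster than the total tilted mass e^(n Gamma(l)), so
   by subadditivity the ball carries that mass; undoing the tilting there
   costs e^(- n l y) up to a small error. Negative dependence gives Gamma <=
   Lambda, independence gives equality of the two defining sequences. *)
From HB Require Import structures.
From mathcomp Require Import all_boot all_order all_algebra.
From mathcomp Require Import all_classical all_reals all_analysis.
From mathcomp Require Import measurable_realfun lra ring.
Require Import Defs.
Import Order.TTheory GRing.Theory Num.Theory.
Import numFieldNormedType.Exports.
Local Open Scope classical_set_scope.
Local Open Scope ring_scope.
Local Open Scope ereal_scope.

(** * Upper expectations and upper probabilities *)

Section upper_expectation_theory.
Context (d : measure_display) (T : measurableType d) (R : realType).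
Variable P : set (probability T R).
Implicit Types (Y Z : T -> R) (A : set T).

Lemma upper_expectation_le Y Z :
  measurable_fun [set: T] Y -> measurable_fun [set: T] Z ->
  (forall w, 0 <= Y w)%R -> (forall w, Y w <= Z w)%R ->
  upper_expectation P Y <= upper_expectation P Z.
Proof.
move=> mY mZ Y0 YZ; apply: ge_ereal_sup => _ [Q PQ <-].
apply: le_ereal_sup_tmp; exists 'E_Q[Z]; first by exists Q.
apply: expectation_le => //; last exact: aeW.
by move=> w; apply: le_trans (YZ w).
Qed.

Lemma upper_expectation_indic A : measurable A ->
  upper_expectation P \1_A = upper_prob P A.
Proof.
move=> mA; rewrite /upper_expectation /upper_prob.
by congr (ereal_sup _); apply: eq_imagel => Q _; rewrite expectation_indic.
Qed.

Lemma upper_expectationD_le Y Z :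
  measurable_fun [set: T] Y -> measurable_fun [set: T] Z ->
  (forall w, 0 <= Y w)%R -> (forall w, 0 <= Z w)%R ->
  upper_expectation P (fun w => Y w + Z w)%R <=
    upper_expectation P Y + upper_expectation P Z.
Proof.
move=> mY mZ Y0 Z0; apply: ge_ereal_sup => _ [Q PQ <-].
rewrite (_ : 'E_Q[_] = 'E_Q[Y] + 'E_Q[Z]).
  by apply: leeD; apply: ereal_sup_ubound; exists Q.
rewrite unlock; under eq_integral do rewrite EFinD.
by rewrite ge0_integralD//;
  do ?[exact/measurable_EFinP|move=> w _; rewrite lee_fin].
Qed.

Lemma upper_expectationZ_le (c : R) Y :
  measurable_fun [set: T] Y -> (0 <= c)%R -> (forall w, 0 <= Y w)%R ->
  upper_expectation P (fun w => c * Y w)%R <= c%:E * upper_expectation P Y.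
Proof.
move=> mY c0 Y0; apply: ge_ereal_sup => _ [Q PQ <-].
rewrite (_ : 'E_Q[_] = c%:E * 'E_Q[Y]).
  by apply: lee_wpmul2l; rewrite ?lee_fin//; apply: ereal_sup_ubound; exists Q.
rewrite unlock; under eq_integral do rewrite EFinM.
by rewrite ge0_integralZl_EFin//;
  do ?[exact/measurable_EFinP|move=> w _; rewrite lee_fin].
Qed.

Lemma upper_prob_le A B : measurable A -> measurable B -> A `<=` B ->
  upper_prob P A <= upper_prob P B.
Proof.
move=> mA mB AB; apply: ge_ereal_sup => _ [Q PQ <-].
apply: le_ereal_sup_tmp; exists (Q B); first by exists Q.
by apply: le_measure; rewrite ?inE.
Qed.

Hypothesis P_nonempty : P !=set0.

Lemma upper_expectation_ge0 Y : (forall w, 0 <= Y w)%R ->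
  0 <= upper_expectation P Y.
Proof.
move=> Y0; have [Q PQ] := P_nonempty.
apply: le_ereal_sup_tmp; exists 'E_Q[Y]; first by exists Q.
exact: expectation_ge0.
Qed.

(** If some [Q] in [P] gave a zero integral, [Y] would vanish [Q]-almost everywhere, although it
    vanishes nowhere and [Q] has mass one. Positivity is what lets the logarithm of a product of
    upper expectations split into a sum. *)
Lemma upper_expectation_gt0 Y : measurable_fun [set: T] Y ->
  (forall w, 0 < Y w)%R -> 0 < upper_expectation P Y.
Proof.
move=> mY Y0; have [Q PQ] := P_nonempty.
apply: (@lt_le_trans _ _ 'E_Q[Y]); last by apply: ereal_sup_ubound; exists Q.
rewrite lt_neqAle expectation_ge0 ?andbT; last by move=> w; apply: ltW.
apply/eqP; rewrite unlock => /esym EY0.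
have /ae_eq_integral_abs : measurable_fun [set: T] (EFin \o Y).
  exact/measurable_EFinP.
move=> /(_ Q measurableT)[+ _].
under eq_integral do rewrite gee0_abs ?lee_fin ?ltW//.
move=> /(_ EY0)[N [mN N0 YN]].
have : Q [set: T] = 0.
  apply/eqP; rewrite eq_le measure_ge0 andbT -N0 le_measure ?inE// => w _.
  by apply: YN => /= /(_ I)[] /eqP; rewrite gt_eqF.
by rewrite probability_setT => /eqP; rewrite onee_eq0.
Qed.

Lemma upper_expectation_cst (c : R) : upper_expectation P (fun=> c) = c%:E.
Proof.
rewrite /upper_expectation (_ : [set _ | _ in _] = [set c%:E]) ?ereal_sup1//.
apply/seteqP; split=> [_ [Q PQ <-]|_ ->]; first exact: expectation_cst.
by have [Q PQ] := P_nonempty; exists Q => //; exact: expectation_cst.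
Qed.

Lemma upper_prob_ge0 A : 0 <= upper_prob P A.
Proof.
have [Q PQ] := P_nonempty.
by apply: le_ereal_sup_tmp; exists (Q A); [exists Q|].
Qed.

End upper_expectation_theory.

(** * Limits superior and exponential rates *)

Section exponential_rates.
Context (R : realType).
Implicit Types (u : nat -> \bar R) (x : \bar R) (r g : R) (n : nat).

Lemma limn_esup_lt_near u x : limn_esup u < x ->
  \forall n \near \oo, u n <= x.
Proof.
move=> /ereal_inf_lt[_ [A nA <-]] ux; near=> n.
by apply: le_trans (ltW ux); apply: ereal_sup_ubound; exists n => //; near: n.
Unshelve. all: by end_near. Qed.

Lemma limn_esup_le u x : (\forall n \near \oo, u n <= x) -> limn_esup u <= x.
Proof.
move=> ux; apply: ge_ereal_inf; eexists.
  by exists [set n | u n <= x].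
by apply: ge_ereal_sup => _ [n /= ? <-].
Qed.

Lemma lt_limn_einf_near u x : x < limn_einf u ->
  \forall n \near \oo, x <= u n.
Proof.
rewrite /limn_einf lteNr => /limn_esup_lt_near; apply: filterS => n.
by rewrite leeN2.
Qed.

Lemma le_limn_einf u x : (\forall n \near \oo, x <= u n) -> x <= limn_einf u.
Proof.
move=> ux; rewrite /limn_einf leeNr; apply: limn_esup_le.
by apply: filterS ux => n; rewrite leeN2.
Qed.

(** Trades logarithmic rates for plain inequalities, to which subadditivity applies. The case
    [x = 0] is included, as [lne 0] is [-oo]. *)
Lemma exp_rate_le n x g : (0 < n)%N -> 0 <= x ->
  ((n%:R^-1)%:E * lne x <= g%:E) = (x <= (expR (n%:R * g))%:E).
Proof.
move=> n0 x0; rewrite lee_pdivrMl ?ltr0n// -EFinM -[LHS]lee_expeR lneK//.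
by rewrite in_itv/= x0 leey.
Qed.

Lemma exp_rate_ge n x g : (0 < n)%N -> 0 <= x ->
  (g%:E <= (n%:R^-1)%:E * lne x) = ((expR (n%:R * g))%:E <= x).
Proof.
move=> n0 x0; rewrite lee_pdivlMl ?ltr0n// -EFinM -[LHS]lee_expeR lneK//.
by rewrite in_itv/= x0 leey.
Qed.

(** Any gap between two rates eventually absorbs the factor 2 that subadditivity costs;
    [1 + x <= expR x] makes this explicit. *)
Lemma near_double_expR r g : (r < g)%R ->
  \forall n \near \oo, (2 * expR (n%:R * r) <= expR (n%:R * g))%R.
Proof.
move=> rg; near=> n.
rewrite (_ : (n%:R * g = n%:R * (g - r) + n%:R * r)%R); last by ring.
rewrite expRD ler_pM2r ?expR_gt0//.
apply: le_trans (expR_ge1Dx _).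
rewrite -lerBlDl -ler_pdivrMr ?subr_gt0//.
near: n; exact: nbhs_infty_ger.
Unshelve. all: by end_near. Qed.

Lemma ereal_real_between (x y : \bar R) : x < y ->
  exists2 r, x < r%:E & r%:E < y.
Proof.
case: x y => [x| |] [y| |]//; rewrite ?lte_fin.
- move=> xy; exists ((x + y) / 2)%R; rewrite lte_fin; lra.
- by move=> _; exists (x + 1)%R; rewrite ?ltry// lte_fin; lra.
- by move=> _; exists (y - 1)%R; rewrite ?ltNyr// lte_fin; lra.
- by move=> _; exists 0%R; rewrite ?ltNyr ?ltry.
Qed.

End exponential_rates.

(** * Fenchel-Legendre transforms and infima *)

Lemma fenchel_legendre_gt (R : realType) (f : R -> \bar R) (x c : R) :
  c%:E < fenchel_legendre f x -> exists l, f l < (l * x - c)%:E.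
Proof.
move=> /ereal_sup_gt[_ [l _ <-] cl]; exists l; move: cl.
case: (f l) => [s| |]//=; rewrite ?ltNyr// -EFinB !lte_fin; lra.
Qed.

Lemma ereal_inf_imageS (I : Type) (R : realType) (f : I -> \bar R)
    (A B : set I) :
  A `<=` B -> ereal_inf [set f x | x in B] <= ereal_inf [set f x | x in A].
Proof. by move=> AB; apply: ereal_inf_le_tmp; exact: image_subset. Qed.

(** * Gartner-Ellis bounds for a general sequence [M] *)

Section gartner_ellis.
Context (d : measure_display) (T : measurableType d) (R : realType).
Variables (P : set (probability T R)) (M : nat -> T -> R).
Hypothesis P_nonempty : P !=set0.
Hypothesis mM : forall n, measurable_fun [set: T] (M n).

(** For [M := sample_mean X] this unfolds to [Gamma_seq P X], and [log_mgf] to [Gamma P X], so the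
    bounds below transfer by conversion. *)
Definition log_mgf_seq (l : R) (n : nat) : \bar R :=
  (n%:R^-1)%:E * lne (upper_expectation P (fun w => expR (n%:R * l * M n w)%R)).

Definition log_mgf (l : R) : \bar R := limn_esup (log_mgf_seq l).

(** The exponentially tilted mass of [A], left unnormalised. *)
Definition tilted (l : R) (n : nat) (A : set R) : \bar R :=
  upper_expectation P (fun w => expR (n%:R * l * M n w) * \1_A (M n w))%R.

(** The strict gap [r' < r] makes the notion stable under finite unions. *)
Definition decays (l r : R) (A : set R) : Prop :=
  exists2 r', (r' < r)%R &
    \forall n \near \oo, tilted l n A <= (expR (n%:R * r'))%:E.

Let measurable_expM (l : R) n :
  measurable_fun [set: T] (fun w => expR (n%:R * l * M n w))%R.
Proof. by apply: measurableT_comp => //; exact: measurable_funM. Qed.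

Let measurable_preimageM n (A : set R) : measurable A ->
  measurable (M n @^-1` A).
Proof. by move=> mA; rewrite -[_ @^-1` _]setTI; exact: mM. Qed.

Let measurable_tilted (l : R) n (A : set R) : measurable A ->
  measurable_fun [set: T] (fun w => expR (n%:R * l * M n w) * \1_A (M n w))%R.
Proof.
move=> mA; apply: measurable_funM => //.
by apply: (measurableT_comp (measurable_indic mA)).
Qed.

Let indic01 (A : set R) x : (0 <= \1_A x :> R)%R /\ (\1_A x <= 1 :> R)%R.
Proof. by rewrite indicE; case: (x \in A). Qed.

Let tilted_integrand_ge0 (l : R) n (A : set R) w :
  (0 <= expR (n%:R * l * M n w) * \1_A (M n w))%R.
Proof. by rewrite mulr_ge0 ?expR_ge0//; case: (indic01 A (M n w)). Qed.

Lemma tilted_le l n A B : measurable A -> measurable B -> A `<=` B ->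
  tilted l n A <= tilted l n B.
Proof.
move=> mA mB AB.
apply: upper_expectation_le => //; try exact: measurable_tilted.
move=> w; rewrite ler_wpM2l ?expR_ge0// !indicE ler_nat.
by case: (boolP (M n w \in A)) => //; rewrite inE => /AB; rewrite -inE => ->.
Qed.

Lemma tiltedU_le l n A B : measurable A -> measurable B ->
  tilted l n (A `|` B) <= tilted l n A + tilted l n B.
Proof.
move=> mA mB.
apply: le_trans; last first.
  by apply: upper_expectationD_le => //; exact: measurable_tilted.
apply: upper_expectation_le => //.
- by apply: measurable_tilted; exact: measurableU.
- by apply: measurable_funD; exact: measurable_tilted.
- move=> w; rewrite -mulrDr ler_wpM2l ?expR_ge0//.
  rewrite !indicE in_setU -natrD ler_nat.
  by case: (M n w \in A); case: (M n w \in B).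
Qed.

Lemma tilted0 n A : measurable A -> tilted 0%R n A = upper_prob P (M n @^-1` A).
Proof.
move=> mA; rewrite -upper_expectation_indic; last exact: measurable_preimageM.
rewrite /tilted; congr upper_expectation; apply/funext => w.
by rewrite mulr0 mul0r expR0 mul1r.
Qed.

Lemma tiltedT l n :
  tilted l n [set: R] =
  upper_expectation P (fun w => expR (n%:R * l * M n w)%R).
Proof.
rewrite /tilted; congr upper_expectation; apply/funext => w.
by rewrite indicE in_setT mulr1.
Qed.

Lemma decays_sub l r A B : measurable A -> measurable B -> A `<=` B ->
  decays l r B -> decays l r A.
Proof.
move=> mA mB AB [r' r'r nearB]; exists r' => //; apply: filterS nearB => n.
exact/le_trans/tilted_le.
Qed.

Lemma decays_set0 l r : decays l r set0.
Proof.
exists (r - 1)%R; first lra.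
apply: nearW => n; rewrite /tilted (_ : (fun w => _) = (fun=> 0%R)).
  by rewrite upper_expectation_cst// lee_fin expR_ge0.
by apply/funext => w; rewrite indicE in_set0 mulr0.
Qed.

(** Subadditivity bounds the union by twice the larger exponential, and a rate [m] strictly between
    the larger rate and [r] absorbs the 2. *)
Lemma decaysU l r A B : measurable A -> measurable B ->
  decays l r A -> decays l r B -> decays l r (A `|` B).
Proof.
move=> mA mB [r1 r1r nearA] [r2 r2r nearB].
have [m m_lt mr] : exists2 m, (Num.max r1 r2 < m)%R & (m < r)%R.
  have : (Num.max r1 r2 < r)%R by rewrite gt_max r1r.
  by exists ((Num.max r1 r2 + r) / 2)%R; lra.
exists m => //; near=> n.
apply: le_trans (tiltedU_le l n A B mA mB) _.
apply: (@le_trans _ _ (2 * expR (n%:R * Num.max r1 r2))%:E).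
  rewrite [(2 * _)%R]mulr_natl mulr2n EFinD; apply: leeD.
  - apply: (@le_trans _ _ (expR (n%:R * r1))%:E); first by near: n.
    by rewrite lee_fin ler_expR ler_wpM2l// le_max lexx.
  - apply: (@le_trans _ _ (expR (n%:R * r2))%:E); first by near: n.
    by rewrite lee_fin ler_expR ler_wpM2l// le_max lexx orbT.
by rewrite lee_fin; near: n; exact: near_double_expR.
Unshelve. all: by end_near. Qed.

Lemma log_mgf_lt_near l g : log_mgf l < g%:E ->
  \forall n \near \oo,
    upper_expectation P (fun w => expR (n%:R * l * M n w)%R)
      <= (expR (n%:R * g))%:E.
Proof.
move=> /limn_esup_lt_near lg; near=> n; rewrite -exp_rate_le.
- by near: n.
- by near: n; exact: nbhs_infty_gt.
- by apply: upper_expectation_ge0 => // w; exact: expR_ge0.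
Unshelve. all: by end_near. Qed.

(** A pair is a slope and a threshold; the sign of the slope decides whether the half-line is a
    right or a left one. *)
Let half_line (i : R * R) : set R := [set x | (i.2 < i.1 * x)%R].

Let open_half_line i : open (half_line i).
Proof.
rewrite (_ : half_line i = ( *%R i.1) @^-1` [set x | (i.2 < x)%R])//.
by apply: open_comp; [move=> x _; exact: mulrl_continuous | exact: open_gt].
Qed.

(* Chernoff's bound for the tilted expectation. *)
Lemma decays_half_line l r i : log_mgf (l + i.1)%R < (r + i.2)%:E ->
  decays l r (half_line i).
Proof.
move=> /ereal_real_between[g lg]; rewrite lte_fin => gr.
exists (g - i.2)%R; first lra.
have := log_mgf_lt_near _ _ lg; apply: filterS => n bound.
(* With [i = (t, b)], the indicator of the half-line is at most e^(n (t x - b)); this shifts the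
   tilt from [l] to [l + t]. *)
apply: (@le_trans _ _ ((expR (- (n%:R * i.2)))%:E *
    upper_expectation P (fun w => expR (n%:R * (l + i.1) * M n w)%R))).
  apply: le_trans; last first.
    by apply: upper_expectationZ_le => // *; exact: expR_ge0.
  apply: upper_expectation_le => //.
  - by apply: measurable_tilted; apply: open_measurable; exact: open_half_line.
  - by apply: measurable_funM.
  - move=> w; rewrite indicE; case: (boolP (_ \in _)).
      rewrite inE /half_line /= mulr1 -expRD ler_expR => iM.
      have n0 : (0 <= n%:R :> R)%R by [].
      by have := ler_wpM2l n0 (ltW iM); lra.
    by rewrite mulr0 mulr_ge0// expR_ge0.
rewrite (_ : (n%:R * (g - i.2) = - (n%:R * i.2) + n%:R * g)%R); last by ring.
by rewrite expRD EFinM; apply: lee_wpmul2l; rewrite ?lee_fin ?expR_ge0.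
Qed.

(** Induction on [s]: the first half-line is split off, and what remains of [A] is covered by the
    others. *)
Lemma decays_half_lines l r (s : seq (R * R)) (A : set R) : measurable A ->
  (forall i, i \in s -> log_mgf (l + i.1)%R < (r + i.2)%:E) ->
  A `<=` [set x | exists2 i, i \in s & half_line i x] -> decays l r A.
Proof.
elim: s A => [|i s IHs] A mA sr As.
  rewrite (_ : A = set0); first exact: decays_set0.
  by apply/seteqP; split=> // x /As[].
have mi : measurable (half_line i).
  by apply: open_measurable; exact: open_half_line.
apply: (@decays_sub l r _ (half_line i `|` (A `\` half_line i))) => //.
- by apply: measurableU => //; exact: measurableD.
- by move=> x Ax; have [|] := pselect (half_line i x); [left|right].
apply: decaysU => //; first exact: measurableD.
  by apply: decays_half_line; apply: sr; rewrite mem_head.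
apply: IHs; first exact: measurableD.
  by move=> j js; apply: sr; rewrite inE js orbT.
move=> x [/As[j]]; rewrite inE => /predU1P[-> //|js jx _].
by exists j.
Qed.

Lemma decays_closed l r (F : set R) : closed F ->
  (exists2 t, (0 < t)%R & log_mgf (l + t)%R < +oo) ->
  (exists2 t, (t < 0)%R & log_mgf (l + t)%R < +oo) ->
  (forall x, F x -> exists t, log_mgf (l + t)%R < (r + t * x)%:E) ->
  decays l r F.
Proof.
move=> cF [t1 t1_gt0 fin1] [t2 t2_lt0 fin2] Fr.
(* For a tail the threshold is free, so finiteness alone yields an admissible half-line of slope
   [t]. *)
have bound t : log_mgf (l + t)%R < +oo ->
    exists b, log_mgf (l + t)%R < (r + b)%:E.
  move=> /ereal_real_between[g lg _]; exists (g - r)%R.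
  by rewrite (_ : (r + (g - r) = g)%R)//; ring.
have [b1 lt1] := bound _ fin1; have [b2 lt2] := bound _ fin2.
pose D : set (R * R) := [set i | log_mgf (l + i.1)%R < (r + i.2)%:E].
(* The part of [F] outside both tails; since [t2 < 0], the second half-line is the set of [x] below
   [b2 / t2]. *)
pose K := F `&` `[(b2 / t2)%R, (b1 / t1)%R]%classic.
have cK : compact K.
  by rewrite /K setIC; apply: compact_closedI => //; exact: segment_compact.
move: cK; rewrite compact_cover => /(_ _ D half_line).
case=> [i _|x [/Fr[t rt] _]|s sD sK].
- exact: open_half_line.
(* A value [g] strictly between leaves room on both sides: threshold [g - r] is admissible and still
   strictly below [t * x]. *)
- have [g lg] := ereal_real_between _ _ _ rt; rewrite lte_fin => gr.
  exists (t, g - r)%R; last by rewrite /half_line /=; lra.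
  by rewrite /D /= (_ : (r + (g - r) = g)%R)//; ring.
apply: (@decays_half_lines l r [:: (t1, b1), (t2, b2) & finmap.enum_fset s]).
- exact: closed_measurable.
- move=> i; rewrite !inE => /or3P[/eqP->//|/eqP->//|/sD].
  by rewrite inE.
- move=> x Fx /=.
  have [x1|x1] := ltP (b1 / t1)%R x.
    exists (t1, b1); first by rewrite mem_head.
    by move: x1; rewrite /half_line /= ltr_pdivrMr// mulrC.
  have [x2|x2] := ltP x (b2 / t2)%R.
    exists (t2, b2); first by rewrite !inE eqxx orbT.
    by move: x2; rewrite /half_line /= ltr_ndivlMr// mulrC.
  have [|i si ix] := sK x; first by split=> //=; rewrite in_itv/= x1 x2.
  by exists i => //; rewrite !inE; apply/or3P/Or33.
Qed.

(** According to the sign of [M n w], the exponential at [l] is dominated by the one at [b] or at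
    [a], hence by their sum. *)
Lemma log_mgf_between a b l : (a <= l <= b)%R ->
  log_mgf a < +oo -> log_mgf b < +oo -> log_mgf l < +oo.
Proof.
move=> /andP[al lb] /ereal_real_between[ga aga _] /ereal_real_between[gb bgb _].
pose g := (Num.max ga gb + 1)%R.
apply: (@le_lt_trans _ _ g%:E); last exact: ltry.
apply: limn_esup_le; near=> n; rewrite exp_rate_le; last 2 first.
- by near: n; exact: nbhs_infty_gt.
- by apply: upper_expectation_ge0 => // w; exact: expR_ge0.
apply: (@le_trans _ _ (2 * expR (n%:R * Num.max ga gb))%:E); last first.
  by rewrite lee_fin; near: n; apply: near_double_expR; rewrite /g; lra.
apply: (@le_trans _ _ (upper_expectation P (fun w => expR (n%:R * a * M n w)%R)
   + upper_expectation P (fun w => expR (n%:R * b * M n w)%R))).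
  apply: le_trans; last first.
    by apply: upper_expectationD_le => // w; exact: expR_ge0.
  apply: upper_expectation_le => //; first exact: measurable_funD.
  move=> w; have n0 : (0 <= n%:R :> R)%R by [].
  have [M0|M0] := leP 0%R (M n w).
    apply: (@le_trans _ _ (expR (n%:R * b * M n w))); last first.
      by rewrite lerDr expR_ge0.
    by rewrite ler_expR; apply: ler_wpM2r => //; exact: ler_wpM2l.
  apply: (@le_trans _ _ (expR (n%:R * a * M n w))); last first.
    by rewrite lerDl expR_ge0.
  by rewrite ler_expR; apply: ler_wnM2r; [exact: ltW|exact: ler_wpM2l].
rewrite [(2 * _)%R]mulr_natl mulr2n EFinD; apply: leeD.
- apply: (@le_trans _ _ (expR (n%:R * ga))%:E).
    by near: n; exact: log_mgf_lt_near.
  by rewrite lee_fin ler_expR ler_wpM2l// le_max lexx.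
- apply: (@le_trans _ _ (expR (n%:R * gb))%:E).
    by near: n; exact: log_mgf_lt_near.
  by rewrite lee_fin ler_expR ler_wpM2l// le_max lexx orbT.
Unshelve. all: by end_near. Qed.

Lemma gartner_ellis_upper (F : set R) : closed F ->
  (exists2 t, (0 < t)%R & log_mgf t < +oo) ->
  (exists2 t, (t < 0)%R & log_mgf t < +oo) ->
  limn_esup (fun n => (n%:R^-1)%:E * lne (upper_prob P (M n @^-1` F)))
    <= - ereal_inf [set fenchel_legendre log_mgf x | x in F].
Proof.
move=> cF [t1 t1_gt0 fin1] [t2 t2_lt0 fin2].
rewrite leNgt; apply/negP => /ereal_real_between[r Fr].
apply/negP; rewrite -leNgt.
have [||x Fx|r' r'r near_r'] := @decays_closed 0%R r F cF.
- by exists t1; rewrite ?add0r.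
- by exists t2; rewrite ?add0r.
(* As [- r] lies below the infimum over [F], each [x] in [F] has a slope [l] with
   [log_mgf l < r + l * x]. *)
- have /fenchel_legendre_gt[l lx] : (- r)%:E < fenchel_legendre log_mgf x.
    rewrite EFinN lteNl; apply: le_lt_trans Fr; rewrite leeN2.
    by apply: ereal_inf_lbound; exists x.
  by exists l; rewrite add0r addrC -[r]opprK.
apply: (@le_trans _ _ r'%:E); last by rewrite lee_fin ltW.
apply: limn_esup_le; near=> n; rewrite exp_rate_le.
- by rewrite -tilted0; [near: n | exact: closed_measurable].
- by near: n; exact: nbhs_infty_gt.
- exact: upper_prob_ge0.
Unshelve. all: by end_near. Qed.

Lemma gartner_ellis_lower (G : set R) (y l : R) : open G -> G y ->
  exposed_with (fenchel_legendre log_mgf) y l ->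
  log_mgf_seq l @ \oo --> log_mgf l ->
  (exists2 t, (l < t)%R & log_mgf t < +oo) ->
  (exists2 t, (t < l)%R & log_mgf t < +oo) ->
  - fenchel_legendre log_mgf y
    <= limn_einf (fun n => (n%:R^-1)%:E * lne (upper_prob P (M n @^-1` G))).
Proof.
move=> oG Gy exposed cvg_l [t1 t1_gt fin1] [t2 t2_lt fin2].
have FLy : (l * y)%:E - log_mgf l <= fenchel_legendre log_mgf y.
  by apply: ereal_sup_ubound; exists l.
have fin_l : log_mgf l < +oo by apply: (log_mgf_between t2 t1); rewrite ?ltW.
(* If [log_mgf l] is [-oo], the transform at [y] is [+oo] and the bound is trivial. *)
case def_r: (log_mgf l) fin_l FLy exposed => [r| |]// _ FLy exposed; last first.
  by move: FLy; rewrite /= leye_eq => /eqP ->; rewrite leNye.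
(* Exposedness and [FLy] make the transform at [x] exceed [l * x - r]. A slope [m] witnessing this
   gives [t = m - l]. *)
have {exposed} far x : x != y -> exists t, log_mgf (l + t)%R < (r + t * x)%:E.
  move=> /exposed ltxy.
  have /fenchel_legendre_gt[m mx] : (l * x - r)%:E < fenchel_legendre log_mgf x.
    move: FLy ltxy; case: (fenchel_legendre log_mgf x) => [a| |];
      case: (fenchel_legendre log_mgf y) => [b| |]//=;
      rewrite -?EFinB ?lee_fin ?lte_fin ?ltry//; lra.
  exists (m - l)%R; rewrite (_ : (l + (m - l) = m)%R); last by ring.
  by rewrite (_ : (r + (m - l) * x = m * x - (l * x - r))%R)//; ring.
apply: (@le_trans _ _ (r - l * y)%:E).
  by rewrite leeNl; apply: le_trans FLy; rewrite -EFinN -EFinB lee_fin; lra.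
apply/lee_addgt0Pr => e e0; rewrite -leeBlDr// -EFinB.
have [eps /= eps0 epsG] : exists2 eps : R, (0 < eps)%R & ball y eps `<=` G.
  by have /nbhs_ballP[eps eps0 epsG] := open_nbhs_nbhs (conj oG Gy); exists eps.
(* The radius keeps the ball inside [G] and the cost [|l| * del] of undoing the tilt below [e / 2];
   the [+ 1] covers [l = 0]. *)
pose del := Num.min eps (e / (2 * (`|l| + 1)))%R.
have l1 : (0 < `|l| + 1)%R by have := normr_ge0 l; lra.
have del0 : (0 < del)%R by rewrite lt_min eps0 divr_gt0// mulr_gt0.
have ldel : (`|l| * del <= e / 2)%R.
  apply: (@le_trans _ _ ((`|l| + 1) * (e / (2 * (`|l| + 1))))%R); last first.
    by rewrite invfM mulrCA [X in (_ * X)%R]mulrCA divff ?mulr1 ?gt_eqF.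
  by apply: ler_pM => //; [exact: ltW|lra|rewrite ge_min lexx orbT].
pose B : set R := ball y del.
have BG : B `<=` G.
  by apply: subset_trans epsG; apply: le_ball; rewrite ge_min lexx.
have mB : measurable B by apply: open_measurable; exact: ball_open.
have mG : measurable G by exact: open_measurable.
have [|||x /= Bx|r' r'r near_r'] := @decays_closed l r (~` B).
- by apply: open_closedC; exact: ball_open.
- by exists (t1 - l)%R; [lra | rewrite (_ : (l + (t1 - l) = t1)%R)//; ring].
- by exists (t2 - l)%R; [lra | rewrite (_ : (l + (t2 - l) = t2)%R)//; ring].
- by apply: far; apply: contra_notN Bx => /eqP ->; exact: ballxx.
(* Chosen so that [r' < r2 < r1 < r] and [r2 >= r - e / 2]: [r1] bounds the total mass from below,
   [r2] the mass off the ball from above. *)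
pose r1 := (r - Num.min (r - r') e / 4)%R.
pose r2 := (r - Num.min (r - r') e / 2)%R.
have mn : (0 < Num.min (r - r') e)%R by rewrite lt_min e0 andbT; lra.
have mn1 : (Num.min (r - r') e <= r - r')%R by rewrite ge_min lexx.
have mn2 : (Num.min (r - r') e <= e)%R by rewrite ge_min lexx orbT.
apply: le_limn_einf; near=> n.
have n_gt0 : (0 < n)%N by near: n; exact: nbhs_infty_gt.
rewrite exp_rate_ge//; last exact: upper_prob_ge0.
apply: (@le_trans _ _ (upper_prob P (M n @^-1` B))); last first.
  by apply: upper_prob_le; do ?exact: measurable_preimageM; move=> w /BG.
have tB : tilted l n B
    <= (expR (n%:R * (l * y + `|l| * del)))%:E * upper_prob P (M n @^-1` B).
  rewrite -tilted0// /tilted.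
  apply: le_trans; last first.
    apply: upper_expectationZ_le; [exact: measurable_tilted|exact: expR_ge0|].
    by move=> w; exact: tilted_integrand_ge0.
  apply: upper_expectation_le => //; first exact: measurable_tilted.
    by apply: measurable_funM => //; exact: measurable_tilted.
  move=> w; rewrite mulr0 mul0r expR0 mul1r indicE.
  case: (boolP (_ \in _)); last by rewrite !mulr0.
  rewrite inE /B /ball /= => yM; rewrite !mulr1 ler_expR -mulrA ler_wpM2l//.
  rewrite -lerBlDl -mulrBr; apply: le_trans (ler_norm _) _.
  by rewrite normrM ler_wpM2l// distrC ltW.
(* Here convergence at [l] enters: the lower limit of [log_mgf_seq l] is also [r], so the total mass
   is eventually large for every [n]. *)
have T_ge : (expR (n%:R * r1))%:E <= tilted l n B + tilted l n (~` B).
  apply: le_trans (tiltedU_le _ _ _ _ mB (measurableC mB)).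
  rewrite setUv tiltedT -exp_rate_ge//; last first.
    by apply: upper_expectation_ge0 => // w; exact: expR_ge0.
  near: n; apply: lt_limn_einf_near.
  have [-> _] := cvg_limn_einf_sup cvg_l.
  by rewrite def_r lte_fin /r1; lra.
have C_le : tilted l n (~` B) <= (expR (n%:R * r2))%:E.
  apply: (@le_trans _ _ (expR (n%:R * r'))%:E); first by near: n.
  by rewrite lee_fin ler_expR ler_wpM2l// /r2; lra.
have r12 : (2 * expR (n%:R * r2) <= expR (n%:R * r1))%R.
  by near: n; apply: near_double_expR; rewrite /r1 /r2; lra.
(* The total is at least [2 * expR (n * r2)] and the complement takes at most one of the two terms,
   so cancellation leaves the other for [B]. *)
have B_ge : (expR (n%:R * r2))%:E <= tilted l n B.
  have : (expR (n%:R * r2))%:E + (expR (n%:R * r2))%:E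
      <= tilted l n B + (expR (n%:R * r2))%:E.
    apply: le_trans (leeD2l _ C_le); apply: le_trans T_ge.
    by rewrite -EFinD lee_fin; lra.
  by rewrite leeD2rE.
have := le_trans B_ge tB; rewrite -lee_pdivrMl ?expR_gt0//; apply: le_trans.
rewrite -expRN -EFinM -expRD lee_fin ler_expR.
rewrite (_ : (- _ + _ = n%:R * (r2 - (l * y + `|l| * del)))%R); last by ring.
by rewrite ler_wpM2l// /r2; lra.
Unshelve. all: by end_near. Qed.

End gartner_ellis.

(** * Sample means under negative dependence and independence *)

Section sample_means.
Context (d : measure_display) (T : measurableType d) (R : realType).
Variables (P : set (probability T R)) (X : nat -> {mfun T >-> R}).
Hypothesis P_nonempty : P !=set0.
Hypothesis X_moments : forall (delta : R) (n : nat), (0 < delta)%R ->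
  upper_expectation P (fun w => expR (delta * `|X n w|)%R) < +oo.

Let measurable_sumX n : measurable_fun [set: T] (fun w => \sum_(i < n) X i w)%R.
Proof. by apply: measurable_sum => i. Qed.

Lemma measurable_sample_mean n : measurable_fun [set: T] (sample_mean X n).
Proof. exact: measurable_funM. Qed.

Let measurable_exp_sum (l : R) n :
  measurable_fun [set: T] (fun w => expR (l * \sum_(i < n) X i w))%R.
Proof. by apply: measurableT_comp => //; exact: measurable_funM. Qed.

Let measurable_exp_abs (l : R) i :
  measurable_fun [set: T] (fun w => expR (l * `|X i w|))%R.
Proof.
apply: measurableT_comp => //; apply: measurable_funM => //.
exact: measurableT_comp.
Qed.

Let measurable_exp_sum_abs (l : R) n :
  measurable_fun [set: T] (fun w => expR (l * \sum_(i < n) `|X i w|))%R.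
Proof.
apply: measurableT_comp => //; apply: measurable_funM => //.
by apply: measurable_sum => i; exact: measurableT_comp.
Qed.

(** Provides the finiteness that [product_rule] presupposes. From e^(delta (a + b)) <= e^(2 delta a)
    + e^(2 delta b), the induction passes to [2 * delta], hence [delta] stays general in it. *)
Lemma sum_abs_moments (delta : R) n : (0 < delta)%R ->
  upper_expectation P (fun w => expR (delta * \sum_(i < n) `|X i w|)%R) < +oo.
Proof.
elim: n delta => [|n IHn] delta delta0.
  under [X in upper_expectation _ X]eq_fun do rewrite big_ord0 mulr0 expR0.
  by rewrite upper_expectation_cst// ltry.
have delta2 : (0 < 2 * delta)%R by lra.
apply: le_lt_trans (lte_add_pinfty (IHn _ delta2) (X_moments _ n delta2)).
apply: le_trans; last by apply: upper_expectationD_le => // w; exact: expR_ge0.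
apply: upper_expectation_le => //; first exact: measurable_funD.
move=> w; rewrite big_ord_recr/=.
set a := (\sum_(i < n) _)%R; set b := (`|X n w|)%R.
have [ab|ba] := leP a b.
  apply: (@le_trans _ _ (expR (2 * delta * b))); last by rewrite lerDr expR_ge0.
  by rewrite ler_expR [(2 * _)%R]mulrC -mulrA ler_wpM2l ?(ltW delta0)//; lra.
apply: (@le_trans _ _ (expR (2 * delta * a))); last by rewrite lerDl expR_ge0.
by rewrite ler_expR [(2 * _)%R]mulrC -mulrA ler_wpM2l ?(ltW delta0)//; lra.
Qed.

Lemma mgf_sum_fin_num (l : R) n :
  upper_expectation P (fun w => expR (l * \sum_(i < n) X i w)%R) \is a fin_num.
Proof.
rewrite ge0_fin_numE; last first.
  by apply: upper_expectation_ge0 => // w; exact: expR_ge0.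
have l1 : (0 < `|l| + 1)%R by have := normr_ge0 l; lra.
apply: le_lt_trans (sum_abs_moments _ n l1).
apply: upper_expectation_le => // w; rewrite ler_expR.
apply: le_trans (ler_norm _) _; rewrite normrM ler_pM//; first by lra.
exact: ler_norm_sum.
Qed.

Lemma mgf_fin_num (l : R) n :
  upper_expectation P (fun w => expR (l * X n w)%R) \is a fin_num.
Proof.
rewrite ge0_fin_numE; last first.
  by apply: upper_expectation_ge0 => // w; exact: expR_ge0.
have l1 : (0 < `|l| + 1)%R by have := normr_ge0 l; lra.
apply: le_lt_trans (X_moments _ n l1).
apply: upper_expectation_le => //.
  by apply: measurableT_comp => //; exact: measurable_funM.
move=> w; rewrite ler_expR.
by apply: le_trans (ler_norm _) _; rewrite normrM ler_pM//; lra.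
Qed.

(** Every [phi i] is taken to be the exponential of slope [l]; keeping [rel_op] abstract serves both
    forms of dependence. *)
Lemma product_rule_mgf (rel_op : \bar R -> \bar R -> Prop) (l : R) n :
  product_rule rel_op P X -> (0 < n)%N ->
  rel_op (upper_expectation P (fun w => expR (l * \sum_(i < n.+1) X i w)%R))
    (upper_expectation P (fun w => expR (l * \sum_(i < n) X i w)%R) *
     upper_expectation P (fun w => expR (l * X n w)%R)).
Proof.
move=> rule n0.
have prodE m : (fun w => \prod_(i < m) expR (l * X i w))%R =
    (fun w => expR (l * \sum_(i < m) X i w))%R.
  by apply/funext => w; rewrite mulr_sumr expR_sum.
have mphi (i : nat) : measurable_fun [set: R] (fun x => expR (l * x))%R.
  by apply: measurableT_comp => //; exact: measurable_funM.
have := rule n (fun _ x => expR (l * x)%R) n0 mphi (fun _ _ => expR_ge0 _).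
cbv beta zeta; rewrite !prodE => ruleE.
apply: ruleE; [exact: mgf_sum_fin_num|exact: mgf_sum_fin_num|].
exact: mgf_fin_num.
Qed.

Let lne_mgfM (l : R) n :
  lne (upper_expectation P (fun w => expR (l * \sum_(i < n) X i w)%R) *
       upper_expectation P (fun w => expR (l * X n w)%R)) =
  lne (upper_expectation P (fun w => expR (l * \sum_(i < n) X i w)%R)) +
  lne (upper_expectation P (fun w => expR (l * X n w)%R)).
Proof.
have mX : measurable_fun [set: T] (fun w => expR (l * X n w))%R.
  by apply: measurableT_comp => //; exact: measurable_funM.
apply: lneM; rewrite in_itv/= leey andbT.
  apply: (upper_expectation_gt0 _ _ _ _ P_nonempty).
    exact: measurable_exp_sum.
  by move=> w; exact: expR_gt0.
by apply: (upper_expectation_gt0 _ _ _ _ P_nonempty _ mX) => w; exact: expR_gt0.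
Qed.

(** The product rule needs at least one factor on the left, so the inductions below start at one
    summand and the empty sum is treated apart. *)
Let lne_mgf_sum1 (l : R) :
  lne (upper_expectation P (fun w => expR (l * \sum_(i < 1) X i w)%R)) =
  \sum_(i < 1) lne (upper_expectation P (fun w => expR (l * X i w)%R)).
Proof. by rewrite big_ord1; under eq_fun do rewrite big_ord1. Qed.

Let lne_mgf_sum0 (l : R) :
  lne (upper_expectation P (fun w => expR (l * \sum_(i < 0) X i w)%R)) =
  \sum_(i < 0) lne (upper_expectation P (fun w => expR (l * X i w)%R)).
Proof.
under [X in upper_expectation _ X]eq_fun do rewrite big_ord0 mulr0 expR0.
by rewrite big_ord0 upper_expectation_cst// lne1.
Qed.

Lemma lne_mgf_sum_le (l : R) n : negatively_dependent P X ->
  lne (upper_expectation P (fun w => expR (l * \sum_(i < n) X i w)%R)) <=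
  \sum_(i < n) lne (upper_expectation P (fun w => expR (l * X i w)%R)).
Proof.
move=> nd; case: n => [|n]; first by rewrite lne_mgf_sum0.
elim: n => [|n IHn]; first by rewrite lne_mgf_sum1.
rewrite big_ord_recr/=; apply: le_trans (leeD2r _ IHn).
rewrite -lne_mgfM lee_lne; first exact: (product_rule_mgf (fun a b => a <= b)).
- rewrite in_itv/= leey andbT.
  by apply: upper_expectation_ge0 => // w; exact: expR_ge0.
- rewrite in_itv/= leey andbT mule_ge0//;
  by apply: upper_expectation_ge0 => // w; exact: expR_ge0.
Qed.

Lemma lne_mgf_sum_eq (l : R) n : independent P X ->
  lne (upper_expectation P (fun w => expR (l * \sum_(i < n) X i w)%R)) =
  \sum_(i < n) lne (upper_expectation P (fun w => expR (l * X i w)%R)).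
Proof.
move=> ind; case: n => [|n]; first exact: lne_mgf_sum0.
elim: n => [|n IHn]; first exact: lne_mgf_sum1.
rewrite big_ord_recr/= -IHn -lne_mgfM; congr lne.
exact: (product_rule_mgf (fun a b => a = b)).
Qed.

(** The factor [n] cancels the one in the mean for [n > 0]; at [n = 0] both sides vanish because the
    inverse of 0 is 0. *)
Lemma Gamma_seqE (l : R) n : Gamma_seq P X l n = (n%:R^-1)%:E *
  lne (upper_expectation P (fun w => expR (l * \sum_(i < n) X i w)%R)).
Proof.
rewrite /Gamma_seq; case: n => [|n]; first by rewrite invr0 !mul0e.
congr (_ * lne (upper_expectation _ _)); apply/funext => w.
by congr expR; rewrite /sample_mean -mulrA [(l * _)%R]mulrCA mulVKf ?pnatr_eq0.
Qed.

Lemma Gamma_le_Lambda (l : R) : negatively_dependent P X ->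
  cvgn (Lambda_seq P X l) -> Gamma P X l <= Lambda P X l.
Proof.
move=> nd cvg_l; rewrite /Lambda -(is_cvg_limn_esupE cvg_l).
rewrite leNgt; apply/negP => /ereal_real_between[r Lr].
apply/negP; rewrite -leNgt.
apply: limn_esup_le; apply: filterS (limn_esup_lt_near _ _ _ Lr) => n.
apply: le_trans; rewrite Gamma_seqE; apply: lee_wpmul2l.
  by rewrite lee_fin invr_ge0.
exact: lne_mgf_sum_le.
Qed.

Lemma independent_Gamma_seqE : independent P X ->
  Gamma_seq P X = Lambda_seq P X.
Proof.
move=> ind; apply/funext => l; apply/funext => n.
by rewrite Gamma_seqE lne_mgf_sum_eq.
Qed.

End sample_means.

(** * Large deviation bounds for the sample means *)

Theorem corollary4p3 (d : measure_display) (T : measurableType d)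
  (R : realType) (P : set (probability T R)) (X : nat -> {mfun T >-> R})
  (P_nonempty : P !=set0)
  (X_nd : negatively_dependent P X)
  (X_moments : forall (delta : R) (n : nat), (0 < delta)%R ->
     upper_expectation P (fun w => expR (delta * `|X n w|)%R) < +oo)
  (Lambda_cvg : forall l : R, cvgn (Lambda_seq P X l))
  (Lambda_dom : interior (dom (Lambda P X)) 0%R) :
  [/\ forall F : set R, closed F ->
        limn_esup (log_prob_seq P X F)
          <= - ereal_inf [set fenchel_legendre (Gamma P X) x | x in F] /\
        - ereal_inf [set fenchel_legendre (Gamma P X) x | x in F]
          <= - ereal_inf [set fenchel_legendre (Lambda P X) x | x in F],
      forall G : set R, open G ->
        - ereal_inf [set fenchel_legendre (Gamma P X) x
                    | x in G `&` exposed_Gamma P X]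
          <= limn_einf (log_prob_seq P X G) &
      independent P X ->
      [/\ Lambda P X = Gamma P X,
          fenchel_legendre (Lambda P X) = fenchel_legendre (Gamma P X),
          exposed_Lambda P X `<=` exposed_Gamma P X,
          forall F : set R, closed F ->
            limn_esup (log_prob_seq P X F)
              <= - ereal_inf [set fenchel_legendre (Lambda P X) x | x in F] &
          forall G : set R, open G ->
            - ereal_inf [set fenchel_legendre (Lambda P X) x
                        | x in G `&` exposed_Lambda P X]
              <= limn_einf (log_prob_seq P X G)]].

Proof.
(* Since [Gamma] lies below [Lambda], interior points of the domain of [Lambda] have a whole ball on
   which [Gamma] is below [+oo]. *)
have nbhs_dom l : interior (dom (Lambda P X)) l ->
    exists2 e : R, (0 < e)%R &
      forall x, (`|l - x| < e)%R -> Gamma P X x < +oo.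
  move=> /nbhs_ballP[e /= e0 be]; exists e => // x /be /=.
  exact/le_lt_trans/Gamma_le_Lambda.
have [e e0 fin_e] := nbhs_dom _ Lambda_dom.
have fin_pos : exists2 t, (0 < t)%R & Gamma P X t < +oo.
  exists (e / 2)%R; first lra.
  by apply: fin_e; rewrite sub0r normrN gtr0_norm; lra.
have fin_neg : exists2 t, (t < 0)%R & Gamma P X t < +oo.
  exists (- (e / 2))%R; first lra.
  by apply: fin_e; rewrite sub0r opprK gtr0_norm; lra.
have mM := measurable_sample_mean _ _ _ X.
have upper F : closed F -> limn_esup (log_prob_seq P X F)
    <= - ereal_inf [set fenchel_legendre (Gamma P X) x | x in F].
  move=> cF; exact: (gartner_ellis_upper _ _ _ _ _ P_nonempty mM).
have lower G : open G -> - ereal_inf [set fenchel_legendre (Gamma P X) x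
      | x in G `&` exposed_Gamma P X] <= limn_einf (log_prob_seq P X G).
  move=> oG; rewrite leeNl; apply: le_ereal_inf_tmp.
  move=> _ [y [Gy [l [exp_l cvg_l [t [t1 fin_t]]]]] <-]; rewrite leeNl.
  have fin0 : Gamma P X 0%R < +oo by apply: fin_e; rewrite subrr normr0.
  (* Finiteness on both sides of [l]: for [l != 0], the point [t * l] lies beyond [l] and 0 on the
     other side; for [l = 0], [fin_pos] and [fin_neg] serve. *)
  apply: (gartner_ellis_lower _ _ _ _ _ P_nonempty mM _ y l) => //;
    have [l0|l0|->//] := ltgtP l 0%R.
  - by exists 0%R.
  - by exists (t * l)%R; [rewrite ltr_pMl|exact: fin_t].
  - by exists (t * l)%R; [rewrite gtr_nMl|exact: fin_t].
  - by exists 0%R.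
split=> [F cF|//|ind].
  split; first exact: upper.
  (* The transform reverses order, so [Gamma <= Lambda] gives the comparison pointwise. *)
  rewrite leeN2; apply: le_ereal_inf_tmp => _ [x Fx <-].
  apply: ge_ereal_inf.
  exists (fenchel_legendre (Lambda P X) x); first by exists x.
  apply: ge_ereal_sup => _ [l _ <-]; apply: le_ereal_sup_tmp.
  exists ((l * x)%:E - Gamma P X l); first by exists l.
  by apply: leeB => //; exact: Gamma_le_Lambda.
have seqE := independent_Gamma_seqE _ _ _ _ _ P_nonempty X_moments ind.
have LG : Lambda P X = Gamma P X.
  by apply/funext => l; rewrite /Gamma seqE is_cvg_limn_esupE.
have exposedS : exposed_Lambda P X `<=` exposed_Gamma P X.
  move=> y [l [exp_l /nbhs_dom[a a0 fin_a]]]; exists l; split.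
  - by rewrite -LG.
  - by rewrite -LG seqE; exact: Lambda_cvg.
  - have l1 : (0 < `|l| + 1)%R by have := normr_ge0 l; lra.
    have c0 : (0 < a / (`|l| + 1))%R by exact: divr_gt0.
    (* Then [t * l] differs from [l] by [a * |l| / (|l| + 1)] in absolute value, which is less than
       the radius [a]. *)
    exists (1 + a / (`|l| + 1))%R; split; first by lra.
    apply: fin_a; rewrite mulrDl mul1r opprD addNKr normrN normrM gtr0_norm//.
    by rewrite mulrAC ltr_pdivrMr// ltr_pM2l//; lra.
split=> // [|F cF|G oG]; rewrite LG//; first exact: upper.
apply: le_trans (lower _ oG); rewrite leeN2; apply: ereal_inf_imageS.
exact: setIS.
Qed.
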